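(* Let $(X,\mu)$ be a non-atomic probability space equipped with a tree $\mathcal{T}$, with associated maximal operator $\mathcal{M}_{\mathcal{T}}$, and let $p>1$. Let $\phi:X\to\mathbb{R}^+$ be a (non-negative measurable) function with $\int_X\phi\,d\mu=f$. Then for every $q\in[1,p]$ $$\int_X(\mathcal{M}_{\mathcal{T}}\phi)^p\,d\mu\ \le\ -\frac{q}{p-1}\,f^p+\left(\frac{p}{p-1}\right)^q\int_X\phi^q(\mathcal{M}_{\mathcal{T}}\phi)^{p-q}\,d\mu .$$ Additionally, this inequality is best possible for any given $q\in[1,p]$ and $f>0$: for every $C>\frac{q}{p-1}$ there is a non-negative measurable $\phi$ on $X$ with $\int_X\phi\,d\mu=f$ such that $$\int_X(\mathcal{M}_{\mathcal{T}}\phi)^p\,d\mu\ >\ -C f^p+\left(\frac{p}{p-1}\right)^q\int_X\phi^q(\mathcal{M}_{\mathcal{T}}\phi)^{p-q}\,d\mu .$$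
   Context: Let $(X,\mu)$ be a non-atomic probability space. A set $\mathcal{T}$ of measurable subsets of $X$ is called a tree if: (i) $X\in\mathcal{T}$ and $\mu(I)>0$ for every $I\in\mathcal{T}$; (ii) to every $I\in\mathcal{T}$ there corresponds a finite or countable subset $C(I)\subseteq\mathcal{T}$ containing at least two elements, such that the elements of $C(I)$ are pairwise disjoint subsets of $I$ and $I=\bigcup C(I)$; (iii) $\mathcal{T}=\bigcup_{m\ge0}\mathcal{T}_{(m)}$, where $\mathcal{T}_{(0)}=\{X\}$ and $\mathcal{T}_{(m+1)}=\bigcup_{I\in\mathcal{T}_{(m)}}C(I)$; (iv) $\lim_{m\to\infty}\sup_{I\in\mathcal{T}_{(m)}}\mu(I)=0$; (v) $\mathcal{T}$ differentiates $L^1(X,\mu)$, i.e. for every $\phi\in L^1(X,\mu)$, for $\mu$-almost every $x\in X$, $\frac{1}{\mu(I)}\int_I\phi\,d\mu\to\phi(x)$ as $\mu(I)\to0$ with $x\in I\in\mathcal{T}$. The associated maximal operator is $\mathcal{M}_{\mathcal{T}}\phi(x)=\sup\left\{\frac{1}{\mu(I)}\int_I|\phi|\,d\mu:\ x\in I\in\mathcal{T}\right\}$ for $\phi\in L^1(X,\mu)$. Here $f$ is a finite number, and integrals of non-negative functions are taken in $[0,+\infty]$ (the inequality is read in the extended sense if they are infinite). *)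

(* Defs.v *)
From HB Require Import structures.
From mathcomp Require Import all_boot all_order all_algebra.
From mathcomp Require Import all_classical all_reals all_analysis.

Set Implicit Arguments.
Unset Strict Implicit.
Unset Printing Implicit Defensive.

Import Order.TTheory GRing.Theory Num.Theory.
Import numFieldNormedType.Exports.

Local Open Scope classical_set_scope.
Local Open Scope ring_scope.
Local Open Scope ereal_scope.

Section Trees.
Context {R : realType} {d : measure_display} {X : measurableType d}.
Implicit Types (mu : probability X R) (T : set (set X)) (phi : X -> R).

Definition nonatomic mu : Prop :=
  forall A : set X, measurable A -> 0 < mu A ->
    exists B : set X, [/\ measurable B, B `<=` A, 0 < mu B & mu B < mu A].

Fixpoint tree_level (C : set X -> set (set X)) (m : nat) : set (set X) :=
  if m is m'.+1 then \bigcup_(I in tree_level C m') C I else [set [set: X]].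

(* For phi real-valued, mu I > 0 and mu I finite, [mu I]^-1 is the inverse of a
   positive real number. *)
Definition average mu phi (I : set X) : \bar R :=
  (mu I)^-1 * \int[mu]_(y in I) (phi y)%:E.

(* The limit is along I in T containing x, as mu I tends to 0. *)
Definition differentiates_L1 mu T : Prop :=
  forall phi, mu.-integrable [set: X] (EFin \o phi) ->
    {ae mu, forall x, forall eps : R, (0 < eps)%R ->
      exists2 delta : R, (0 < delta)%R &
        forall I, T I -> I x -> mu I < delta%:E ->
          `|average mu phi I - (phi x)%:E| < eps%:E}.

Record tree_with_children mu T (C : set X -> set (set X)) : Prop := {
  tree_measurable : forall I, T I -> measurable I;
  tree_setT : T [set: X];
  tree_gt0 : forall I, T I -> 0 < mu I;
  children_tree : forall I, T I -> C I `<=` T;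
  children_countable : forall I, T I -> countable (C I);
  children_ge2 : forall I, T I -> exists J K, [/\ C I J, C I K & J <> K];
  children_disjoint : forall I, T I -> trivIset (C I) id;
  children_sub : forall I, T I -> forall J, C I J -> J `<=` I;
  children_cover : forall I, T I -> I = \bigcup_(J in C I) J;
  tree_levels : T = \bigcup_m tree_level C m;
  tree_shrink :
    ereal_sup [set mu I | I in tree_level C m] @[m --> \oo] --> (0 : \bar R);
  tree_differentiates : differentiates_L1 mu T
}.

Definition is_tree mu T : Prop := exists C, tree_with_children mu T C.

Definition maximal_op mu T phi (x : X) : \bar R :=
  ereal_sup [set average mu (fun y => `|phi y|%R) I | I in [set I | T I /\ I x]].

End Trees.

(* Main.v *)
Require Import Defs.
From HB Require Import structures.
From mathcomp Require Import all_boot all_order all_algebra.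
From mathcomp Require Import all_classical all_reals all_analysis.
From mathcomp Require Import measurable_realfun ring lra.
Import Order.TTheory GRing.Theory Num.Theory.
Import numFieldNormedType.Exports.
Local Open Scope classical_set_scope.
Local Open Scope ring_scope.
Set Implicit Arguments.
Unset Strict Implicit.
Unset Printing Implicit Defensive.
Local Open Scope ereal_scope.

(** Throughout, r stands for p / (p - 1), M for the maximal function of phi,
and f for the mean of phi.

Upper bound. The averages a_m of phi over the cells of level m form a
martingale, and M is their supremum. Let t_m be the running maximum of the a_k,
k <= m, cut off at a height N >= f. If t jumps from s to b at level m + 1, the
new average a is at least b, and Young's inequality gives
b^p + r a s^(p-1) <= s^p + r a b^(p-1) ([doob_step_powR]). Since t_m and t_(m+1)
are constant on the cells of level m + 1, the average a_(m+1) may be replaced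
by phi under the integral sign, and the inequalities telescope to
int t_m^p + r f^p <= f^p + r int phi t_m^(p-1) ([doob_inequality]). A second
application of Young's inequality bounds phi t^(p-1) by a combination of
phi^q t^(p-q) and t^p; the last term is absorbed by the left-hand side, which
is legitimate because the truncation makes it finite. Monotone convergence
removes the truncation ([maximal_inequality]).

Sharpness. The pointwise inequality
p (r phi)^q M^(p-q) <= q (r phi)^p + (p - q) M^p shows that a function which is
nearly extremal for the exponent q = p is nearly extremal for every q. For
q = p, consider the numbers D such that every I in the tree carries a function
phi of mean 1 with r^p int_I phi^p <= int_I g^p + D mu(I), where g is a lower
bound of the maximal function computed inside I ([excess_le]). The constant
function 1 shows that D = r^p is such a number. A number D can be improved:
inside I take a union E of tree elements of relative measure 1 - a, put on each
of them a copy of its own function multiplied by 1 + k a, and on the rest of I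
the constant 1 - k + k a. The new function has mean 1 and excess
a ((r (1 - k + k a))^p - 1) + (1 - a) (1 + k a)^p D. For k slightly below 1 / p
and a small this is smaller than D by a fixed multiple of a, as long as D stays
above some D0 > r ([self_improvement_parameters]). Finitely many improvements
bring D below any prescribed D0 > r ([excess_le_limit]), and the resulting
function on the root X is the required near-extremizer. *)

(** * Inequalities between powers *)

Section PowerInequalities.
Context {R : realType}.
Local Open Scope ring_scope.
Implicit Types p q s t x : R.

Lemma bernoulli_powR q t : 1 <= q -> 0 <= t -> q * t <= t `^ q + (q - 1).
Proof.
rewrite le_eqVlt => /predU1P[<-|q1] t0; first by rewrite powRr1// mul1r subrr addr0.
have q0 : 0 < q by lra.
have := @conjugate_powR R t 1 q (q / (q - 1)) t0 ler01 q0.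
rewrite powR1 mulr1 divr_gt0 ?subr_gt0//.
move=> /(_ isT); rewrite invf_div.
have -> : q^-1 + (q - 1) / q = 1 by field; lra.
move=> /(_ erefl) h.
have -> : t `^ q + (q - 1) = q * (t `^ q / q + 1 * ((q - 1) / q)) by field; lra.
by rewrite ler_pM2l.
Qed.

(** [bernoulli_powR] at the point s / t, made homogeneous. It serves with q = p in
[doob_step_powR], and with s = r phi to pass from the exponent 1 to q. *)
Lemma young_powR p q s t : 1 <= q -> 0 <= s -> 0 < t ->
  q * s * t `^ (p - 1) <= s `^ q * t `^ (p - q) + (q - 1) * t `^ p.
Proof.
move=> q1 s0 t0.
have := @bernoulli_powR q (s / t) q1 (divr_ge0 s0 (ltW t0)).
rewrite -(ler_pM2r (powR_gt0 p t0)) => h; apply: le_trans (le_trans h _).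
  rewrite powRB ?(gt_eqF t0) ?implybT// powRr1 ?(ltW t0)// le_eqVlt.
  by apply/orP; left; apply/eqP; field; lra.
rewrite mulrDl powRM ?invr_ge0 ?(ltW t0)// -[t^-1]powR_inv1 ?(ltW t0)// -powRrM mulN1r.
by rewrite -mulrA -powRD ?(gt_eqF t0) ?implybT// [- q + p]addrC.
Qed.

(** [bernoulli_powR] for the exponent p / q at the point (s / t)^q. This is what
compares the exponent q with the exponent p in the proof of sharpness. *)
Lemma young_powR_power p q s t : 1 <= q -> q <= p -> 0 <= s -> 0 < t ->
  p * (s `^ q * t `^ (p - q)) <= q * s `^ p + (p - q) * t `^ p.
Proof.
move=> q1 qp s0 t0.
have q0 : 0 < q by lra.
have pq1 : 1 <= p / q by rewrite ler_pdivlMr// mul1r.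
have := @bernoulli_powR (p / q) ((s / t) `^ q) pq1 (powR_ge0 _ _).
rewrite -powRrM [q * _]mulrC divfK ?gt_eqF//.
rewrite -(ler_pM2r (powR_gt0 p t0)) -(ler_pM2l q0).
rewrite !powRM ?invr_ge0 ?(ltW t0)//.
rewrite -[t^-1]powR_inv1 ?(ltW t0)// -!powRrM !mulN1r.
rewrite !powRN powRB ?(gt_eqF t0) ?implybT//.
have := powR_gt0 q t0; have := powR_gt0 p t0.
set a := t `^ p; set b := t `^ q; set c := s `^ q; set e := s `^ p => a0 b0.
move=> h; apply: le_trans (le_trans h _).
  by rewrite le_eqVlt; apply/orP; left; apply/eqP; field; lra.
by rewrite le_eqVlt; apply/orP; left; apply/eqP; field; lra.
Qed.

(** The number exp (p x) lies in between, since ln (1 + x) <= x and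
1 - y <= exp (- y). *)
Lemma powR_1D_le p x : 0 < p -> 0 <= x -> p * x < 1 -> (1 + x) `^ p <= (1 - p * x)^-1.
Proof.
move=> p0 x0 px.
have x1 : 0 < 1 + x by lra.
rewrite /powR (gt_eqF x1).
have /le_trans -> // : expR (p * ln (1 + x)) <= expR (p * x).
  rewrite ler_expR ler_pM2l// -[leRHS]expRK ler_ln ?posrE ?expR_gt0//.
  exact: expR_ge1Dx.
rewrite -[X in expR X]opprK expRN lef_pV2 ?posrE ?expR_gt0//; last by lra.
exact: expR_ge1Dx.
Qed.

(** The discrete counterpart of d(t^p) = r t d(t^(p-1)) for an increasing t:
the value at the right end of the jump from s to b dominates, and replacing it
by any larger a only helps. *)
Lemma doob_step_powR p s b a : 1 < p -> 0 < s -> s <= b -> b <= a ->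
  b `^ p + p / (p - 1) * (a * s `^ (p - 1)) <=
  s `^ p + p / (p - 1) * (a * b `^ (p - 1)).
Proof.
move=> p1 s0 sb ba.
have b0 : 0 < b by exact: lt_le_trans sb.
have := @young_powR p p b s (ltW p1) (ltW b0) s0.
rewrite subrr powRr0 mulr1 -(mulr_powRB1 (ltW b0)); last by lra.
have : s `^ (p - 1) <= b `^ (p - 1).
  by apply: ge0_ler_powR; rewrite ?nnegrE ?(ltW s0) ?(ltW b0)//; lra.
set u := s `^ (p - 1); set v := b `^ (p - 1) => uv h.
have p10 : 0 < p - 1 by lra.
rewrite -(ler_pM2l p10) !mulrDr !mulrA.
have -> : (p - 1) * p / (p - 1) = p by field; lra.
have : 0 <= p * (a - b) * (v - u) by rewrite !mulr_ge0 ?subr_ge0//; lra.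
lra.
Qed.

(** The parameters of the sharpness construction. At first order in a, the change
of D is a times (r (1 - k))^p - 1 - (1 - p k) D. Writing k = 1 / p - tau, one
has r (1 - k) = 1 + r tau, so the bracket is close to p tau (r - D), which is
negative once D > r. To make this quantitative without derivatives, r is
replaced by the midpoint y of r and C, which leaves room for the perturbation
k a, and the power (1 + y tau)^p is bounded by 1 / (1 - p y tau). *)
Lemma self_improvement_parameters p C : 1 < p -> p / (p - 1) < C ->
  exists k a0 e : R, [/\ 0 < k < 1, 0 < a0 < 1, 0 < e &
   forall a D : R, 0 < a -> a <= a0 -> C <= D ->
    a * ((p / (p - 1) * (1 - k + k * a)) `^ p - 1)
      + (1 - a) * (1 + k * a) `^ p * D <= D - a * e].
Proof.
move=> p1; have [r rE] : exists r, r = p / (p - 1) by exists (p / (p - 1)).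
rewrite -rE => rC.
have r1 : 1 < r by rewrite rE ltr_pdivlMr; lra.
have [y yE] : exists y, y = (r + C) / 2 by eexists.
have ry : r < y by rewrite yE; lra.
have yC : y < C by rewrite yE; lra.
have y0 : 0 < y by lra.
have C0 : 0 < C by lra.
have yC0 : 0 < y * C by rewrite mulr_gt0.
have p0 : 0 < p by lra.
(* Half of the largest tau with (1 + p tau C) (1 - p y tau) >= 1. *)
have [tau tauE] : exists tau, tau = (C - y) / (2 * p * C * y) by eexists.
have tau0 : 0 < tau by rewrite tauE divr_gt0 ?subr_gt0// !mulr_gt0. 
have pytau : p * y * tau < 1 / 2.
  have -> : p * y * tau = (C - y) / (2 * C) by rewrite tauE; field; lra.
  by rewrite ltr_pdivrMr ?mulr_gt0 ?ltr0n//; lra.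
have ptau0 : 0 < p * tau by rewrite mulr_gt0.
have ptau : p * tau < 1 / 2.
  have : 0 < p * tau * (y - 1) by rewrite mulr_gt0// subr_gt0; lra.
  by lra.
have [k kE] : exists k, k = p^-1 - tau by eexists.
have k0 : 0 < k by rewrite kE subr_gt0 -(ltr_pM2l p0) mulfV ?gt_eqF//; lra.
have pk : p * k = 1 - p * tau by rewrite kE mulrBr mulfV// gt_eqF.
have k1 : k < 1.
  have : p^-1 < 1 by rewrite invf_lt1.
  by rewrite kE; lra.
have [e eE] : exists e, e = 1 + p * tau * C - (1 - p * (y * tau))^-1 by eexists.
have e0 : 0 < e.
  rewrite eE subr_gt0 invf_plt ?posrE; [|nra|nra].
  rewrite -div1r ltr_pdivrMr; last by nra.
  have -> : (1 - p * (y * tau)) * (1 + p * tau * C) = 1 + p * tau * (C - y) / 2.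
    by rewrite tauE; field; lra.
  by rewrite ltrDl !mulr_gt0 ?subr_gt0// invr_gt0.
(* The first bound on a gives r tau + r a <= y tau. *)
exists k, (Num.min ((y - r) / r * tau) (1 / 2)), e.
split => //.
- by rewrite k0.
- rewrite lt_min gt_min divr_gt0//; apply/andP; split; last by apply/orP; right; lra.
  by rewrite andbT mulr_gt0// divr_gt0 ?subr_gt0//; lra.
move=> a D a0; rewrite le_min => /andP[a1 a2] CD.
have step1 : (1 - a) * (1 + k * a) `^ p <= 1 - a * (p * tau).
  have pka : p * (k * a) < 1 by rewrite mulrA pk; nra.
  apply: le_trans (_ : (1 - a) * (1 - p * (k * a))^-1 <= _).
    rewrite ler_pM2l; last by lra.
    by apply: powR_1D_le => //; rewrite mulr_ge0// ltW.
  rewrite ler_pdivrMr; last by lra.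
  rewrite [p * (k * a)]mulrA pk; nra.
have step2 : (r * (1 - k + k * a)) `^ p <= (1 - p * (y * tau))^-1.
  apply: le_trans (@powR_1D_le p (y * tau) p0 _ _).
  - apply: ge0_ler_powR; rewrite ?nnegrE.
    + exact: ltW.
    + by rewrite mulr_ge0//; nra.
    + by nra.
    have -> : r * (1 - k + k * a) = 1 + r * tau + r * (k * a).
      by rewrite kE rE; field; lra.
    have -> : y * tau = r * tau + r * ((y - r) / r * tau) by field; lra.
    rewrite addrA lerD2l ler_pM2l; last by lra.
    by apply: le_trans a1; rewrite ger_pMl// ltW.
  - by rewrite mulr_ge0// ltW.
  - by rewrite mulrA; lra.
have D0 : 0 < D by lra.
apply: le_trans (_ : a * ((1 - p * (y * tau))^-1 - 1) + (1 - a * (p * tau)) * D <= _).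
  rewrite lerD//; first by rewrite ler_pM2l// lerD2r.
  by rewrite ler_pM2r.
have -> : (1 - p * (y * tau))^-1 = 1 + p * tau * C - e by rewrite eE; ring.
have : 0 <= a * (p * tau) * (D - C) by rewrite !mulr_ge0 ?subr_ge0// ltW.
lra.
Qed.

End PowerInequalities.

(** * Countable measurable partitions and the levels of a tree *)

Section Partitions.
Context {R : realType} {d : measure_display} {X : measurableType d}.
Variable mu : {measure set X -> \bar R}.
Implicit Types (P Q : set (set X)).

(** The empty set fills the indices that are not used, so that finite and
infinite families are treated alike. *)
Lemma countable_enumeration Q : countable Q -> trivIset Q id ->
  exists F : nat -> set X,
    [/\ forall n, Q (F n) \/ F n = set0, trivIset [set: nat] F
      & \bigcup_n F n = \bigcup_(J in Q) J].
Proof.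
move=> /countable_injP[f finj] tQ.
pose F n := [set x | exists J, [/\ Q J, f J = n & J x]].
have FJ J : Q J -> F (f J) = J.
  move=> QJ; apply/seteqP; split=> [x [K [QK fK Kx]]|x Jx]; last by exists J.
  by have <- : K = J by apply: finj => //; apply/mem_set.
exists F; split.
- move=> n; have [[J [QJ <-]]|nJ] := pselect (exists J, Q J /\ f J = n).
    by left; rewrite FJ.
  by right; apply/seteqP; split => // x [J [QJ fJ _]]; case: nJ; exists J.
- by move=> i j _ _ [x [[J [QJ <- Jx]] [K [QK <- Kx]]]]; congr f; apply: (tQ J K) => //; exists x.
- apply/seteqP; split=> [x [n _ [J [QJ _ Jx]]]|x [J QJ Jx]]; first by exists J.
  by exists (f J) => //; rewrite FJ.
Qed.

Record countable_partition P : Prop := {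
  partition_countable : countable P;
  partition_measurable : P `<=` measurable;
  partition_cover : forall x, exists2 I, P I & I x;
  partition_trivIset : trivIset P id }.

Lemma partition_measurable_fun P d' (Y : measurableType d') (u : X -> Y) :
  countable_partition P -> (forall I x y, P I -> I x -> I y -> u x = u y) ->
  measurable_fun [set: X] u.
Proof.
move=> [cP mP covP tP] uP.
have [F [PF tF UF]] := countable_enumeration cP tP.
have -> : [set: X] = \bigcup_n F n.
  by rewrite UF; apply/seteqP; split => // x _; have [I PI Ix] := covP x; exists I.
have mF n : measurable (F n) by case: (PF n) => [/mP//|->].
apply/measurable_fun_bigcup => // n.
have [F0|/set0P[x Fx]] := eqVneq (F n) set0; first by rewrite F0; exact: measurable_fun_set0.
case: (PF n) => [PFn|F0]; last by move: Fx; rewrite F0.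
apply: (eq_measurable_fun (cst (u x))) => //.
by move=> y /set_mem Fy; exact: (uP (F n)).
Qed.

Lemma partition_eq_integral P (u v : X -> \bar R) :
  countable_partition P ->
  measurable_fun [set: X] u -> measurable_fun [set: X] v ->
  (forall x, 0 <= u x) -> (forall x, 0 <= v x) ->
  (forall I, P I -> \int[mu]_(x in I) u x = \int[mu]_(x in I) v x) ->
  \int[mu]_x u x = \int[mu]_x v x.
Proof.
move=> [cP mP covP tP] mu_ mv u0 v0 uv.
have [F [PF tF UF]] := countable_enumeration cP tP.
have -> : [set: X] = \bigcup_n F n.
  by rewrite UF; apply/seteqP; split => // x _; have [I PI Ix] := covP x; exists I.
have mF n : measurable (F n) by case: (PF n) => [/mP//|->].
rewrite !ge0_integral_bigcup//; [|exact: measurable_funTS..].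
by apply: eq_eseriesr => n _; case: (PF n) => [/uv//|->]; rewrite !integral_set0.
Qed.

End Partitions.

Section TreeGeometry.
Context {R : realType} {d : measure_display} {X : measurableType d}.
Variables (mu : probability X R) (T : set (set X)) (C : set X -> set (set X)).
Hypothesis H : tree_with_children mu T C.

Lemma tree_level_sub m : tree_level C m `<=` T.
Proof. by move=> I Im; rewrite (tree_levels H); exists m. Qed.

Lemma tree_level_exists I : T I -> exists m, tree_level C m I.
Proof. by rewrite {1}(tree_levels H) => -[m _ Im]; exists m. Qed.

Lemma tree_level_partition m : countable_partition (tree_level C m).
Proof.
split.
- elim: m => [|m IH] /=; first exact: countable1.
  apply: bigcup_countable => // I /tree_level_sub; exact: (children_countable H).
- by move=> I /tree_level_sub; exact: (tree_measurable H).
- move=> x; elim: m => [|m [I Im Ix]] /=; first by exists setT.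
  have := Ix; rewrite (children_cover H (tree_level_sub Im)) => -[J CJ Jx].
  by exists J => //; exists I.
- elim: m => [|m IH] /=; first by move=> I J -> ->.
  move=> I J [I' I'm CI] [J' J'm CJ] [x [Ix Jx]].
  have TI' := tree_level_sub I'm; have TJ' := tree_level_sub J'm.
  have E : I' = J'.
    apply: IH => //; exists x; split.
      exact: (children_sub H TI' CI).
    exact: (children_sub H TJ' CJ).
  by apply: (children_disjoint H TI') => //; [rewrite E|exists x].
Qed.

Lemma tree_level_refine k n J : (k <= n)%N -> tree_level C n J ->
  exists2 K, tree_level C k K & J `<=` K.
Proof.
move=> /subnK <-; elim: (n - k)%N J => [|j IH] J; first by exists J.
rewrite addSn => -[I Im CJ]; have [K Kk IK] := IH _ Im; exists K => //.
exact: subset_trans (children_sub H (tree_level_sub Im) CJ) IK.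
Qed.

Lemma tree_level_unique m I J x :
  tree_level C m I -> tree_level C m J -> I x -> J x -> I = J.
Proof.
move=> Im Jm Ix Jx; apply: (partition_trivIset (tree_level_partition m)) => //.
by exists x.
Qed.

End TreeGeometry.

(** * Integrals of nonnegative real functions *)

Section NonnegativeRealIntegrals.
Context {R : realType} {d : measure_display} {X : measurableType d}.
Variables (mu : {measure set X -> \bar R}) (D : set X).
Hypothesis mD : measurable D.
Implicit Types (u v : X -> R).

Lemma ge0_integralD_EFin u v :
  measurable_fun [set: X] u -> measurable_fun [set: X] v ->
  (forall x, 0 <= u x)%R -> (forall x, 0 <= v x)%R ->
  \int[mu]_(x in D) (u x + v x)%:E
  = \int[mu]_(x in D) (u x)%:E + \int[mu]_(x in D) (v x)%:E.
Proof.
move=> mu_ mv u0 v0; under eq_integral do rewrite EFinD.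
by rewrite ge0_integralD//; try (by move=> x _; rewrite lee_fin);
  apply/measurable_EFinP; exact: measurable_funTS.
Qed.

Lemma ge0_integralMl_EFin (c : R) u : (0 <= c)%R ->
  measurable_fun [set: X] u -> (forall x, 0 <= u x)%R ->
  \int[mu]_(x in D) (c * u x)%:E = c%:E * \int[mu]_(x in D) (u x)%:E.
Proof.
move=> c0 mu_ u0; under eq_integral do rewrite EFinM.
rewrite ge0_integralZl//; try (by move=> x _; rewrite lee_fin).
by apply/measurable_EFinP; exact: measurable_funTS.
Qed.

Lemma ge0_le_integral_EFin u v :
  measurable_fun [set: X] u -> measurable_fun [set: X] v ->
  (forall x, D x -> 0 <= u x)%R -> (forall x, D x -> u x <= v x)%R ->
  \int[mu]_(x in D) (u x)%:E <= \int[mu]_(x in D) (v x)%:E.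
Proof.
move=> mu_ mv u0 uv; apply: ge0_le_integral => //.
- by apply/measurable_EFinP; exact: measurable_funTS.
- by apply/measurable_EFinP; exact: measurable_funTS.
Qed.

Lemma le_integral_affine (c : R) u1 v1 u2 v2 : (0 <= c)%R ->
  measurable_fun [set: X] u1 -> measurable_fun [set: X] v1 ->
  measurable_fun [set: X] u2 -> measurable_fun [set: X] v2 ->
  (forall x, 0 <= u1 x)%R -> (forall x, 0 <= v1 x)%R ->
  (forall x, 0 <= u2 x)%R -> (forall x, 0 <= v2 x)%R ->
  (forall x, D x -> u1 x + c * v1 x <= u2 x + c * v2 x)%R ->
  \int[mu]_(x in D) (u1 x)%:E + c%:E * \int[mu]_(x in D) (v1 x)%:E <=
  \int[mu]_(x in D) (u2 x)%:E + c%:E * \int[mu]_(x in D) (v2 x)%:E.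
Proof.
move=> c0 mu1 mv1 mu2 mv2 u10 v10 u20 v20 h.
have m1 : measurable_fun [set: X] (fun x => c * v1 x)%R by exact: measurable_funM.
have m2 : measurable_fun [set: X] (fun x => c * v2 x)%R by exact: measurable_funM.
have c1 x : (0 <= c * v1 x)%R by exact: mulr_ge0.
have c2 x : (0 <= c * v2 x)%R by exact: mulr_ge0.
rewrite -!ge0_integralMl_EFin// -!ge0_integralD_EFin//.
apply: ge0_le_integral_EFin => //; [exact: measurable_funD..|].
by move=> x _; exact: addr_ge0.
Qed.

End NonnegativeRealIntegrals.

(** * The martingale of averages *)

Section Cells.
Context {R : realType} {d : measure_display} {X : measurableType d}.
Variables (mu : probability X R) (T : set (set X)) (C : set X -> set (set X)).
Hypothesis H : tree_with_children mu T C.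

Definition cell m x : set X := xget setT [set I | tree_level C m I /\ I x].

Lemma cellP m x : tree_level C m (cell m x) /\ cell m x x.
Proof.
rewrite /cell; case: xgetP => [I _ //|no].
by have [I Im Ix] := partition_cover (tree_level_partition H m) x; case: (no I).
Qed.

Lemma cell_tree m x : T (cell m x).
Proof. by apply: (tree_level_sub H); exact: (cellP m x).1. Qed.

Lemma cell_eq m I x : tree_level C m I -> I x -> cell m x = I.
Proof.
by move=> Im Ix; have [c1 c2] := cellP m x; exact: (tree_level_unique H c1 Im c2 Ix).
Qed.

Lemma cell_coarse k m I x y : (k <= m)%N -> tree_level C m I -> I x -> I y ->
  cell k x = cell k y.
Proof.
move=> km Im Ix Iy; have [K Kk IK] := tree_level_refine H km Im.
by rewrite (cell_eq Kk (IK _ Ix)) (cell_eq Kk (IK _ Iy)).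
Qed.

Lemma tree_measure I : T I -> 0 < mu I < +oo.
Proof.
move=> TI; rewrite (tree_gt0 H TI)/=; apply: le_lt_trans (ltry 1).
exact/probability_le1/(tree_measurable H).
Qed.

Section Averages.
Variables (phi : X -> R) (f : R).
Hypothesis mphi : measurable_fun [set: X] phi.
Hypothesis phi0 : forall x, (0 <= phi x)%R.
Hypothesis phif : \int[mu]_x (phi x)%:E = f%:E.

Let emphi D : measurable_fun D (EFin \o phi).
Proof. by apply/measurable_EFinP; exact: measurable_funTS. Qed.

Let ephi0 D x : D x -> 0 <= (phi x)%:E. Proof. by rewrite lee_fin. Qed.

Lemma total_ge0 : (0 <= f)%R.
Proof. by rewrite -lee_fin -phif; apply: integral_ge0 => x _; rewrite lee_fin. Qed.

Lemma average_mul_measure I : T I ->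
  (fine (average mu phi I))%:E * mu I = \int[mu]_(x in I) (phi x)%:E /\
  average mu phi I = (fine (average mu phi I))%:E.
Proof.
move=> TI; have mI := tree_measurable H TI.
have /andP[I0 Ioo] := tree_measure TI.
have fi : \int[mu]_(x in I) (phi x)%:E \is a fin_num.
  rewrite ge0_fin_numE; last by apply: integral_ge0 => x; exact: (@ephi0 I).
  apply: le_lt_trans (ltry f); rewrite -phif.
  by apply: ge0_subset_integral => // x _; rewrite lee_fin.
have fm : mu I \is a fin_num by rewrite ge0_fin_numE.
have m0 : (0 < fine (mu I))%R by rewrite fine_gt0// I0.
rewrite /average -(fineK fm) -(fineK fi) inver (gt_eqF m0) -EFinM /=; split => //.
by congr EFin; field; rewrite gt_eqF.
Qed.

Lemma average_ge0 I : T I -> (0 <= fine (average mu phi I))%R.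
Proof.
move=> TI; have [E _] := average_mul_measure TI.
have /andP[I0 Ioo] := tree_measure TI.
have : 0 <= (fine (average mu phi I))%:E * mu I.
  by rewrite E; apply: integral_ge0 => x _; rewrite lee_fin.
by rewrite pmule_lge0.
Qed.

Definition level_average m x : R := fine (average mu phi (cell m x)).

Lemma level_average_ge0 m x : (0 <= level_average m x)%R.
Proof. exact/average_ge0/cell_tree. Qed.

Lemma level_average0 x : level_average 0 x = f.
Proof.
rewrite /level_average.
have -> : cell 0 x = setT by apply: (@cell_eq 0 setT).
have [+ _] := average_mul_measure (tree_setT H).
by rewrite phif probability_setT mule1 => -[].
Qed.

Lemma level_average_cell k m I x y : (k <= m)%N -> tree_level C m I ->
  I x -> I y -> level_average k x = level_average k y.
Proof.
by move=> km Im Ix Iy; rewrite /level_average (cell_coarse km Im Ix Iy).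
Qed.

Lemma measurable_level_average m : measurable_fun [set: X] (level_average m).
Proof.
apply: (partition_measurable_fun (tree_level_partition H m)) => I x y.
exact: level_average_cell.
Qed.

(** The martingale property: on each cell of level m, the weight h is a constant
and the average of phi has the same integral as phi. *)
Lemma integral_level_average m (h : X -> R) :
  (forall I x y, tree_level C m I -> I x -> I y -> h x = h y) ->
  (forall x, 0 <= h x)%R ->
  \int[mu]_x (level_average m x * h x)%:E = \int[mu]_x (phi x * h x)%:E.
Proof.
move=> hI h0.
have mh : measurable_fun [set: X] h.
  by apply: (partition_measurable_fun (tree_level_partition H m)) => I x y; exact: hI.
apply: (partition_eq_integral (tree_level_partition H m)).
- by apply/measurable_EFinP/measurable_funM => //; exact: measurable_level_average.
- by apply/measurable_EFinP/measurable_funM.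
- by move=> x; rewrite lee_fin mulr_ge0// level_average_ge0.
- by move=> x; rewrite lee_fin mulr_ge0.
move=> I Im; have TI := tree_level_sub H Im.
have mI := tree_measurable H TI.
have [I0|/set0P[x Ix]] := eqVneq I set0; first by rewrite I0 !integral_set0.
have [E _] := average_mul_measure TI.
have -> : \int[mu]_(y in I) (phi y * h y)%:E = \int[mu]_(y in I) (h x * phi y)%:E.
  apply: eq_integral => y /set_mem Iy; by rewrite (hI I y x)// mulrC.
rewrite ge0_integralMl_EFin//.
have -> : \int[mu]_(y in I) (level_average m y * h y)%:E
   = \int[mu]_(y in I) cst ((h x * fine (average mu phi I))%:E) y.
  apply: eq_integral => y /set_mem Iy /=.
  by rewrite (hI I y x)// /level_average (cell_eq Im Iy) mulrC.
by rewrite integral_cst// EFinM -muleA E.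
Qed.

(** The tree elements that contain x are exactly its cells, one for each level. *)
Lemma maximal_opE x :
  maximal_op mu T phi x = ereal_sup [set (level_average m x)%:E | m in [set: nat]].
Proof.
rewrite /maximal_op (_ : (fun y => `|phi y|%R) = phi); last first.
  by apply/funext => y; rewrite ger0_norm.
congr ereal_sup; apply/seteqP; split => [_ [I [TI Ix] <-]|_ [m _ <-]].
  have [m Im] := tree_level_exists H TI; exists m => //.
  by rewrite /level_average (cell_eq Im Ix) -(average_mul_measure TI).2.
exists (cell m x); first by split; [exact: cell_tree|exact: (cellP m x).2].
by rewrite (average_mul_measure (cell_tree m x)).2.
Qed.

Lemma measurable_maximal_op : measurable_fun [set: X] (maximal_op mu T phi).
Proof.
have -> : maximal_op mu T phi = fun x => esups (fun m => (level_average m x)%:E) 0%N.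
  apply/funext => x; rewrite maximal_opE /esups /sdrop; congr ereal_sup.
  apply/seteqP; split => _ [m _ <-]; exists m => //=.
apply: measurable_fun_esups => m; apply/measurable_EFinP.
exact: measurable_level_average.
Qed.

Lemma maximal_op_ge x : f%:E <= maximal_op mu T phi x.
Proof.
by rewrite maximal_opE -(level_average0 x); apply: ereal_sup_ubound; exists 0%N.
Qed.

Lemma maximal_op_ge0 x : 0 <= maximal_op mu T phi x.
Proof. by apply: le_trans (maximal_op_ge x); rewrite lee_fin total_ge0. Qed.

End Averages.
End Cells.

(** * The upper bound *)

Lemma telescope_step {R : realType} (A A' Y Y' : \bar R) (F K c : R) :
  A \is a fin_num -> A' \is a fin_num -> Y \is a fin_num -> Y' \is a fin_num ->
  A + K%:E <= F%:E + c%:E * Y -> A' + c%:E * Y <= A + c%:E * Y' ->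
  A' + K%:E <= F%:E + c%:E * Y'.
Proof.
move=> /fineK <- /fineK <- /fineK <- /fineK <-.
by rewrite -!EFinM -!EFinD !lee_fin; lra.
Qed.

(** How Young's inequality raises the exponent from 1 to q: the term
(q - 1) A is moved to the left-hand side, which requires A to be finite. *)
Lemma young_absorb {R : realType} (p q F c : R) (A Y B : \bar R) :
  (1 < p)%R -> (1 <= q)%R -> (0 < c)%R ->
  A \is a fin_num -> Y \is a fin_num -> 0 <= B ->
  A + (p / (p - 1) * F)%:E <= F%:E + (p / (p - 1))%:E * Y ->
  (q * (p / (p - 1)))%:E * Y <= c%:E * B + (q - 1)%:E * A ->
  A <= (- (q / (p - 1)) * F)%:E + c%:E * B.
Proof.
move=> p1 q1 c0 /fineK <- /fineK <- B0.
have [->|/eqP Boo] := eqVneq B +oo.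
  by move=> _ _; rewrite gt0_muley ?lte_fin// addey// leey.
have /fineK <- : B \is a fin_num by rewrite ge0_fin_numE// lt_neqAle leey andbT; apply/eqP.
rewrite -!EFinM -!EFinD !lee_fin => h1 h2.
have q0 : (0 < q)%R by lra.
move: h1; rewrite -(ler_pM2l q0) => h1.
have -> : (- (q / (p - 1)) * F = q * (F - p / (p - 1) * F))%R by field; lra.
lra.
Qed.

Section UpperBound.
Context {R : realType} {d : measure_display} {X : measurableType d}.
Variables (mu : probability X R) (T : set (set X)) (C : set X -> set (set X)).
Hypothesis H : tree_with_children mu T C.
Variables (phi : X -> R) (f : R).
Hypothesis mphi : measurable_fun [set: X] phi.
Hypothesis phi0 : forall x, (0 <= phi x)%R.
Hypothesis phif : \int[mu]_x (phi x)%:E = f%:E.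

Local Notation a := (level_average mu C phi).
Local Notation M := (maximal_op mu T phi).

(** The truncation at N keeps all integrals finite; it is applied to each average
rather than to the maximum, which makes every bound a plain induction. *)
Fixpoint running_max (N : R) m x : R :=
  if m is k.+1 then Num.max (running_max N k x) (Num.min (a k.+1 x) N)
  else Num.min (a 0%N x) N.

Lemma running_max_cell N m I x y : tree_level C m I -> I x -> I y ->
  running_max N m x = running_max N m y.
Proof.
suff h n : (n <= m)%N -> tree_level C m I -> I x -> I y ->
    running_max N n x = running_max N n y by exact: h.
elim: n => [|n IH] nm Im Ix Iy /=; rewrite (level_average_cell H phi nm Im Ix Iy)//.
by rewrite IH// ltnW.
Qed.

Lemma measurable_running_max N m : measurable_fun [set: X] (running_max N m).
Proof.
apply: (partition_measurable_fun (tree_level_partition H m)) => I x y.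
exact: running_max_cell.
Qed.

Lemma running_max_le N m x : (running_max N m x <= N)%R.
Proof. by elim: m => [|m IH] /=; rewrite ?ge_max ?IH/= ge_min lexx orbT. Qed.

Lemma running_max_le_succ N m x : (running_max N m x <= running_max N m.+1 x)%R.
Proof. by rewrite /= le_max lexx. Qed.

Lemma running_max_ge N m k x : (k <= m)%N ->
  (Num.min (a k x) N <= running_max N m x)%R.
Proof.
elim: m => [|m IH]; first by rewrite leqn0 => /eqP ->.
rewrite leq_eqVlt => /predU1P[->/=|]; first by rewrite le_max lexx orbT.
by rewrite ltnS => /IH h; apply: le_trans h (running_max_le_succ _ _ _).
Qed.

Lemma running_max0 N x : (f <= N)%R -> running_max N 0 x = f.
Proof. by move=> fN /=; rewrite (level_average0 H mphi phi0 phif) min_l. Qed.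

Lemma running_max_ge_mean N m x : (f <= N)%R -> (f <= running_max N m x)%R.
Proof.
by move=> fN; apply: le_trans (running_max_ge N x (leq0n m)); rewrite -{1}(running_max0 x fN).
Qed.

Lemma le_running_max N N' m x : (N <= N')%R -> (running_max N m x <= running_max N' m x)%R.
Proof.
move=> NN; elim: m => [|m IH] /=.
  by rewrite le_min !ge_min lexx NN /= orbT.
rewrite ge_max !le_max IH /=; apply/orP; right.
by rewrite le_min !ge_min lexx NN /= orbT.
Qed.

Lemma running_max_le_maximal_op N m x : (running_max N m x)%:E <= M x.
Proof.
rewrite (maximal_opE H mphi phi0 phif).
have h k : (Num.min (a k x) N)%:E <= ereal_sup [set (a m x)%:E | m in [set: nat]].
  apply: le_trans (_ : (a k x)%:E <= _); first by rewrite lee_fin ge_min lexx.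
  by apply: ereal_sup_ubound; exists k.
elim: m => [|m IH]; first exact: h.
by rewrite /= EFin_max ge_max IH h.
Qed.

Section Truncated.
Variables (p : R) (N : R).
Hypotheses (p1 : (1 < p)%R) (f0 : (0 < f)%R) (fN : (f <= N)%R).
Local Notation t := (running_max N).

(* Side conditions of the integral lemmas, which [//] finds in the context. *)
Let t0 m x : (0 < t m x)%R.
Proof. by apply: lt_le_trans f0 _; exact: running_max_ge_mean. Qed.

Let mt s m : measurable_fun [set: X] (fun x => t m x `^ s)%R.
Proof.
by apply: (@measurableT_comp _ _ _ _ _ _ (@powR R ^~ s)); [exact: measurable_powR|exact: measurable_running_max].
Qed.

Let t_ge0 s m x : (0 <= t m x `^ s)%R. Proof. exact: powR_ge0. Qed.

Let mphit s m : measurable_fun [set: X] (fun x => phi x * t m x `^ s)%R.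
Proof. exact: measurable_funM. Qed.

Let mat s j m : measurable_fun [set: X] (fun x => a j x * t m x `^ s)%R.
Proof. by apply: measurable_funM => //; exact: (measurable_level_average H). Qed.

Let phit_ge0 s m x : (0 <= phi x * t m x `^ s)%R. Proof. exact: mulr_ge0. Qed.

Let at_ge0 s j m x : (0 <= a j x * t m x `^ s)%R.
Proof. by rewrite mulr_ge0// (level_average_ge0 H mphi phi0 phif). Qed.

Let r0 : (0 <= p / (p - 1))%R.
Proof. by rewrite divr_ge0//; (move: p1; lra). Qed.

Let tN s m x : (0 <= s)%R -> (t m x `^ s <= N `^ s)%R.
Proof.
move=> s0; apply: ge0_ler_powR; rewrite ?nnegrE ?(ltW (t0 _ _)) ?running_max_le//.
exact: le_trans (ltW f0) fN.
Qed.

Lemma integral_running_max_fin m : \int[mu]_x (t m x `^ p)%:E \is a fin_num.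
Proof.
rewrite ge0_fin_numE; last by apply: integral_ge0 => x _; rewrite lee_fin.
apply: le_lt_trans (ltry (N `^ p)).
apply: le_trans (_ : \int[mu]_x cst (N `^ p)%:E x <= _).
  apply: (@ge0_le_integral_EFin _ _ _ _ _ _ _ (cst (N `^ p)%R)) => //.
  by move=> x _; apply: tN; (move: p1; lra).
by rewrite integral_cst//= probability_setT mule1.
Qed.

Lemma integral_weighted_running_max_fin m :
  \int[mu]_x (phi x * t m x `^ (p - 1))%:E \is a fin_num.
Proof.
rewrite ge0_fin_numE; last by apply: integral_ge0 => x _; rewrite lee_fin.
apply: le_lt_trans (ltry (N `^ (p - 1) * f)).
rewrite EFinM -phif -ge0_integralMl_EFin ?powR_ge0//.
apply: ge0_le_integral_EFin => //; first exact: measurable_funM.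
by move=> x _; rewrite mulrC ler_wpM2r//; apply: tN; (move: p1; lra).
Qed.

(** Integration of [doob_step_powR]. The powers of t_m and t_(m+1) are constant on
the cells of level m + 1, so phi and the average a_(m+1) are interchangeable
as their weights. *)
Lemma doob_step m :
  \int[mu]_x (t m.+1 x `^ p)%:E
    + (p / (p - 1))%:E * \int[mu]_x (phi x * t m x `^ (p - 1))%:E <=
  \int[mu]_x (t m x `^ p)%:E
    + (p / (p - 1))%:E * \int[mu]_x (phi x * t m.+1 x `^ (p - 1))%:E.
Proof.
have E n : (n <= m.+1)%N -> \int[mu]_x (phi x * t n x `^ (p - 1))%:E =
    \int[mu]_x (a m.+1 x * t n x `^ (p - 1))%:E.
  move=> nm; rewrite -(integral_level_average (m := m.+1) H mphi phi0 phif)// => I x y Im Ix Iy.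
  have [K Kn IK] := tree_level_refine H nm Im.
  by rewrite (running_max_cell N Kn (IK _ Ix) (IK _ Iy)).
rewrite (E _ (leqnSn m)) (E _ (leqnn m.+1)).
apply: le_integral_affine; [by []..|].
move=> x _; have [ta|ta] := leP (Num.min (a m.+1 x) N) (t m x).
  by rewrite /= max_l.
apply: doob_step_powR => //; first exact: running_max_le_succ.
by rewrite /= max_r ?(ltW ta)// ge_min lexx.
Qed.

(** The telescoped inequality, which is the case q = 1 for the truncated running
maximum. *)
Lemma doob_inequality m :
  \int[mu]_x (t m x `^ p)%:E + (p / (p - 1) * f `^ p)%:E <=
  (f `^ p)%:E + (p / (p - 1))%:E * \int[mu]_x (phi x * t m x `^ (p - 1))%:E.
Proof.
have p0 : (0 < p)%R by (move: p1; lra).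
elim: m => [|m IH].
  under eq_integral do rewrite running_max0//.
  under [in leRHS]eq_integral do rewrite running_max0// mulrC.
  rewrite (@ge0_integralMl_EFin _ _ _ _ _ _ (f `^ (p - 1))%R phi) ?powR_ge0// phif integral_cst//= probability_setT mule1.
  rewrite -EFinM lee_fin lerD2l (mulrC _ f) mulr_powRB1// ltW//.
exact: (telescope_step (integral_running_max_fin m) (integral_running_max_fin m.+1)
  (integral_weighted_running_max_fin m) (integral_weighted_running_max_fin m.+1)
  IH (doob_step m)).
Qed.

Lemma running_max_inequality q m : (1 <= q)%R -> (q <= p)%R ->
  \int[mu]_x (t m x `^ p)%:E <=
  (- (q / (p - 1)) * f `^ p)%:E
  + ((p / (p - 1)) `^ q)%:E * \int[mu]_x (phi x `^ q * t m x `^ (p - q))%:E.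
Proof.
move=> q1 qp.
have B0 : 0 <= \int[mu]_x (phi x `^ q * t m x `^ (p - q))%:E.
  by apply: integral_ge0 => x _; rewrite lee_fin mulr_ge0// powR_ge0.
have r_gt0 : (0 < p / (p - 1))%R by rewrite divr_gt0//; (move: p1; lra).
have q0 : (0 < q)%R by (move: p1; lra).
have mB : measurable_fun [set: X] (fun x => phi x `^ q * t m x `^ (p - q))%R.
  apply: measurable_funM => //.
  by apply: (@measurableT_comp _ _ _ _ _ _ (@powR R ^~ q)) => //; exact: measurable_powR.
have young : (q * (p / (p - 1)))%:E * \int[mu]_x (phi x * t m x `^ (p - 1))%:E <=
    ((p / (p - 1)) `^ q)%:E * \int[mu]_x (phi x `^ q * t m x `^ (p - q))%:E
    + (q - 1)%:E * \int[mu]_x (t m x `^ p)%:E.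
  have q10 : (0 <= q - 1)%R by (move: p1; lra).
  have qr0 : (0 <= q * (p / (p - 1)))%R by rewrite mulr_ge0// ltW.
  have pp0 x : (0 <= phi x `^ q * t m x `^ (p - q))%R by rewrite mulr_ge0// powR_ge0.
  rewrite -!ge0_integralMl_EFin// ?powR_ge0// -ge0_integralD_EFin//; last first.
  - by move=> x; rewrite mulr_ge0.
  - by move=> x; rewrite mulr_ge0// powR_ge0.
  - exact: measurable_funM.
  - exact: measurable_funM.
  apply: ge0_le_integral_EFin => //.
  - exact: measurable_funM.
  - by apply: measurable_funD; apply: measurable_funM.
  - by move=> x _; rewrite mulr_ge0.
  move=> x _; have := young_powR p q1 (mulr_ge0 r0 (phi0 x)) (t0 m x).
  by rewrite (powRM _ r0 (phi0 x)) !mulrA.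
exact: (young_absorb p1 q1 (powR_gt0 q r_gt0) (integral_running_max_fin m)
  (integral_weighted_running_max_fin m) B0 (doob_inequality m) young).
Qed.

End Truncated.

(** Height of truncation and level are sent to infinity together. The case f = 0
is separate, because Young's inequality was applied at t > 0: there all
averages vanish. *)
Lemma maximal_inequality (p q : R) : (1 < p)%R -> (1 <= q)%R -> (q <= p)%R ->
  \int[mu]_x (M x `^ p) <=
  (- (q / (p - 1)) * f `^ p)%:E
  + ((p / (p - 1)) `^ q)%:E * \int[mu]_x ((phi x `^ q)%:E * M x `^ (p - q)).
Proof.
move=> p1 q1 qp.
have p0 : (0 < p)%R by lra.
have mM := measurable_maximal_op H mphi phi0 phif.
have M0 := maximal_op_ge0 H mphi phi0 phif.
have B0 : 0 <= \int[mu]_x ((phi x `^ q)%:E * M x `^ (p - q)).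
  by apply: integral_ge0 => x _; rewrite mule_ge0 ?poweR_ge0// lee_fin powR_ge0.
have [f0|f0] := leP f 0%R.
  have fE : f = 0%R.
    by apply/eqP; rewrite eq_le f0 (total_ge0 phi0 phif).
  have Mx x : M x = 0.
    apply/eqP; rewrite eq_le M0 andbT (maximal_opE H mphi phi0 phif).
    apply: ge_ereal_sup => _ [m _ <-].
    have TI := cell_tree H m x.
    have [E _] := average_mul_measure H mphi phi0 phif TI.
    have /andP[I0 Ioo] := tree_measure H TI.
    have : (level_average mu C phi m x)%:E * mu (cell C m x) <= 0.
      have -> : 0 = \int[mu]_x (phi x)%:E by rewrite phif fE.
      rewrite E; apply: ge0_subset_integral => //.
      - exact: (tree_measurable H).
      - exact/measurable_EFinP.
      - by move=> y _; rewrite lee_fin.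
    by rewrite pmule_lle0.
  rewrite fE powR0 ?gt_eqF// mulr0 add0e.
  under eq_integral do rewrite Mx poweR0r ?gt_eqF//.
  by rewrite integral0 mule_ge0// lee_fin powR_ge0.
pose t m := running_max (f + m%:R)%R m.
have ft m : (f <= f + m%:R)%R by rewrite lerDl.
have t0 m x : (0 < t m x)%R by apply: lt_le_trans f0 _; exact: running_max_ge_mean.
have ht m : \int[mu]_x (t m x `^ p)%:E <=
  (- (q / (p - 1)) * f `^ p)%:E
  + ((p / (p - 1)) `^ q)%:E * \int[mu]_x ((phi x `^ q)%:E * M x `^ (p - q)).
  apply: le_trans (running_max_inequality p1 f0 (ft m) m q1 qp) _.
  rewrite leeD2l// lee_wpmul2l ?lee_fin ?powR_ge0//.
  have mq (u : X -> R) s : measurable_fun [set: X] u ->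
      measurable_fun [set: X] (fun x => u x `^ s)%R.
    by move=> ?; apply: (@measurableT_comp _ _ _ _ _ _ (@powR R ^~ s)) => //; exact: measurable_powR.
  apply: ge0_le_integral => //.
  - by move=> x _; rewrite lee_fin mulr_ge0// powR_ge0.
  - apply/measurable_EFinP/measurable_funM; apply: mq => //.
    exact: measurable_running_max.
  - apply: emeasurable_funM; first by apply/measurable_EFinP; exact: mq.
    by apply: (@measurableT_comp _ _ _ _ _ _ (@poweR R ^~ (p - q)%R)) => //; exact: measurable_poweR.
  move=> x _; rewrite EFinM lee_wpmul2l ?lee_fin ?powR_ge0// -poweR_EFin.
  apply: gt0_ler_poweR; rewrite ?in_itv/= ?leey ?andbT ?subr_ge0//.
    by rewrite lee_fin; exact: ltW (t0 m x).
  exact: running_max_le_maximal_op.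
have mtp m : measurable_fun [set: X] (fun x => (t m x `^ p)%:E).
  apply/measurable_EFinP.
  by apply: (@measurableT_comp _ _ _ _ _ _ (@powR R ^~ p)); [exact: measurable_powR|exact: measurable_running_max].
have ndt x : {homo (fun m => (t m x `^ p)%:E) : n m / (n <= m)%N >-> n <= m}.
  apply/nondecreasing_seqP => m; rewrite lee_fin.
  apply: ge0_ler_powR; rewrite ?nnegrE ?(ltW p0) ?(ltW (t0 _ _))//.
  rewrite /t; apply: le_trans (le_running_max m x _) (running_max_le_succ _ _ _).
  by rewrite lerD2l ler_nat.
have mMp : measurable_fun [set: X] (fun x => M x `^ p).
  by apply: (@measurableT_comp _ _ _ _ _ _ (@poweR R ^~ p)) => //; exact: measurable_poweR.
have cv := @ereal_nondecreasing_is_cvgn R _ (ndt _).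
have tp0 m x : [set: X] x -> 0 <= (t m x `^ p)%:E by rewrite lee_fin powR_ge0.
apply: (@le_trans _ _ (\int[mu]_x limn (fun m => (t m x `^ p)%:E))); last first.
  rewrite monotone_convergence//; apply: lime_le; last by apply: nearW => m; exact: ht.
  apply: ereal_nondecreasing_is_cvgn => m n mn.
  by apply: ge0_le_integral => // x _; [exact: tp0|exact: ndt].
have mlim : measurable_fun [set: X] (fun x => limn (fun m => (t m x `^ p)%:E)).
  exact: (emeasurable_fun_cvg (fun m x => (t m x `^ p)%:E)).
apply: ge0_le_integral => // x _; first exact: poweR_ge0.
have tlim m : (t m x `^ p)%:E <= limn (fun m => (t m x `^ p)%:E).
  by apply: lime_ge => //; exists m => // n /= mn; exact: ndt.
(* It suffices to bound every average of a tree element containing x by the p-th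
   root of the limit, which avoids any continuity of powers at infinity. *)
have lim0 := le_trans (tp0 0%N x I) (tlim 0%N).
suff Mlim : M x <= limn (fun m => (t m x `^ p)%:E) `^ p^-1.
  rewrite -[leRHS]poweRe1// -(mulVf (lt0r_neq0 p0)) poweRrM.
  apply: gt0_ler_poweR; rewrite ?in_itv/= ?leey ?andbT ?poweR_ge0 ?M0//.
  exact: ltW.
rewrite (maximal_opE H mphi phi0 phif); apply: ge_ereal_sup => _ [k _ <-].
(* A level at which neither the truncation nor the running maximum is below the
   average over the cell of level k. *)
have [n kn nk] : exists2 n, (k <= n)%N & (level_average mu C phi k x <= f + n%:R)%R.
  pose j := (Num.truncn (level_average mu C phi k x)).+1.
  exists (maxn k j); first exact: leq_maxl.
  apply: le_trans (ltW (truncnS_gt _)) _.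
  apply: (@le_trans _ _ (maxn k j)%:R%R); first by rewrite ler_nat leq_maxr.
  by rewrite lerDr ltW.
apply: (@le_trans _ _ ((t n x `^ p)%:E `^ p^-1)).
  rewrite poweR_EFin -powRrM mulfV ?gt_eqF// powRr1 ?(ltW (t0 _ _))// lee_fin.
  by apply: le_trans (running_max_ge _ x kn); rewrite le_min lexx.
apply: gt0_ler_poweR; rewrite ?in_itv/= ?leey ?andbT ?lee_fin ?powR_ge0 ?invr_ge0 ?(ltW p0)//.
Qed.

End UpperBound.

(** * Subsets of a tree element with a prescribed proportion *)

Section Selection.
Context {R : realType} {d : measure_display} {X : measurableType d}.
Variables (mu : probability X R) (T : set (set X)) (C : set X -> set (set X)).
Hypothesis H : tree_with_children mu T C.

Lemma tree_measure_EFin I : T I -> exists2 m : R, (0 < m)%R & mu I = m%:E.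
Proof.
move=> TI; have /andP[] := tree_measure H TI.
by case: (mu I) => [m| |]//; rewrite lte_fin => m0 _; exists m.
Qed.

Lemma probability_EFin (A : set X) : measurable A ->
  exists2 m : R, (0 <= m)%R & mu A = m%:E.
Proof.
move=> mA; have : mu A \is a fin_num.
  by rewrite ge0_fin_numE//; apply: le_lt_trans (probability_le1 mu mA) (ltry 1).
by move=> /fineK mAE; exists (fine (mu A)) => //; exact: fine_ge0.
Qed.

(** By the shrinking condition, the cells of one deep enough level that lie in I
are small, and they cover I since levels refine each other. *)
Lemma tree_fine_partition I (e : R) : T I -> (0 < e)%R ->
  exists F : nat -> set X,
    [/\ forall n, T (F n) \/ F n = set0, forall n, mu (F n) <= e%:E,
        trivIset [set: nat] F & \bigcup_n F n = I].
Proof.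
move=> TI e0; have [k Ik] := tree_level_exists H TI.
have [n kn small] : exists2 n, (k <= n)%N & forall J, tree_level C n J -> mu J < e%:E.
  have [N _ hN] : \forall n \near \oo,
      ereal_sup [set mu J | J in tree_level C n] < e%:E.
    have nb : nbhs (0 : \bar R) [set y | y < e%:E].
      by apply: open_nbhs_nbhs; split; [exact: open_ereal_lt_ereal|rewrite /= lte_fin].
    exact: (tree_shrink H nb).
  exists (maxn k N) => [|J Jn]; first exact: leq_maxl.
  apply: le_lt_trans (hN (maxn k N) (leq_maxr _ _)).
  by apply: ereal_sup_ubound; exists J.
have P := tree_level_partition H n.
pose Q := [set J | tree_level C n J /\ J `<=` I].
have cQ : countable Q.
  by apply: sub_countable (partition_countable P); apply: subset_card_le => J [].
have tQ : trivIset Q id.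
  by move=> J K [Jn _] [Kn _]; apply: (partition_trivIset P).
have [F [QF tF UF]] := countable_enumeration cQ tQ.
exists F; split => //.
- by move=> m; case: (QF m) => [[Fn _]|->]; [left; exact: (tree_level_sub H Fn)|right].
- move=> m; case: (QF m) => [[Fn _]|->]; first exact/ltW/small.
  by rewrite measure0 lee_fin ltW.
rewrite UF; apply/seteqP; split => [x [J [_ JI] Jx]|x Ix]; first exact: JI.
have [J Jn Jx] := partition_cover P x.
have [K Kk JK] := tree_level_refine H kn Jn.
exists J => //; split => //.
by rewrite (tree_level_unique H Ik Kk Ix (JK _ Jx)).
Qed.

(** A union of tree elements of relative measure 1 - a in I, with a in
[al, 2 al]: cells of relative measure at most al are collected until the
measure (1 - al) mu(I) is about to be exceeded, and the first cell left out is
small enough for a <= 2 al. The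
property P is carried along the finitely many unions, which spares its users
any indexing of the family. *)
Lemma tree_fraction (P : set X -> Prop) I (al : R) :
  T I -> (0 < al)%R -> (al < 1)%R ->
  P set0 -> (forall J, T J -> P J) ->
  (forall A B, measurable A -> measurable B -> [disjoint A & B] ->
    P A -> P B -> P (A `|` B)) ->
  exists E a, [/\ measurable E, E `<=` I, P E, (al <= a <= 2 * al)%R
    & mu E = (1 - a)%:E * mu I].
Proof.
move=> TI al0 al1 P0 PT PU.
have [m m0 mI] := tree_measure_EFin TI.
have [F [TF smallF tF UF]] := tree_fine_partition TI (mulr_gt0 al0 m0).
have mF n : measurable (F n) by case: (TF n) => [/(tree_measurable H)//|->].
pose V n := \bigcup_(i < n) F i.
have VS n : V n.+1 = V n `|` F n by rewrite /V IIS bigcup_setU bigcup_set1.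
have mV n : measurable (V n) by apply: bigcup_measurable => i _.
have dV n : [disjoint V n & F n].
  apply/disj_setPS => x [[i /= ni Fi] Fn].
  have E : i = n by apply: tF => //; exists x.
  by move: ni; rewrite E ltnn.
have PV n : P (V n).
  elim: n => [|n IH]; first by rewrite /V II0 bigcup_set0.
  rewrite VS; apply: PU => //.
  by case: (TF n) => [/PT//|->].
have ex : exists n, ((1 - al) * m)%:E < mu (V n).
  apply: contrapT => /forallNP no.
  have UV : \bigcup_n V n = I.
    rewrite -UF; apply/seteqP; split => [x [n _ [i _ Fi]]|x [n _ Fn]]; first by exists i.
    by exists n.+1 => //; exists n => /=.
  have cvV : mu \o V @ \oo --> mu I.
    rewrite -UV; apply: nondecreasing_cvg_mu => //; first by rewrite UV; exact: (tree_measurable H).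
    by apply/nondecreasing_seqP => n; rewrite VS; apply/subsetPset; exact: subsetUl.
  have : mu I <= ((1 - al) * m)%:E.
    by apply: (cvge_to_le cvV); apply: nearW => n /=; rewrite leNgt; apply/negP/no.
  by rewrite mI lee_fin; nra.
case: (ex_minnP ex) => -[|n] hn minn.
  move: hn; rewrite /V II0 bigcup_set0 measure0 lte_fin; nra.
have hV : mu (V n) <= ((1 - al) * m)%:E.
  by rewrite leNgt; apply/negP => /minn; rewrite ltnn.
have [v v0 vE] := probability_EFin (mV n).
have [w w0 wE] := probability_EFin (mF n).
have VE : mu (V n.+1) = mu (V n) + mu (F n).
  by rewrite VS measureU//; apply/disj_set2P.
have := smallF n; move: hn hV; rewrite VE vE wE -EFinD lte_fin !lee_fin => h1 h2 h3.
exists (V n), (1 - v / m)%R; split => //.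
- by move=> x [i _ Fi]; rewrite -UF; exists i.
- apply/andP; split.
    by rewrite lerBrDl -lerBrDr ler_pdivrMr.
  rewrite lerBlDl -lerBlDr ler_pdivlMr//; lra.
by rewrite mI -EFinM vE; congr EFin; field; rewrite gt_eqF.
Qed.

End Selection.

(** * Gluing functions along a measurable set *)

Section Glue.
Context {R : realType} {d : measure_display} {X : measurableType d}.
Variable mu : {measure set X -> \bar R}.
Implicit Types (A B : set X) (u v : X -> R).

Definition glue A u v x : R := if x \in A then u x else v x.

Lemma glue_in A u v x : A x -> glue A u v x = u x.
Proof. by move=> Ax; rewrite /glue mem_set. Qed.

Lemma glue_out A u v x : ~ A x -> glue A u v x = v x.
Proof. by move=> Ax; rewrite /glue memNset. Qed.

Lemma glue_ge0 A u v : (forall x, 0 <= u x)%R -> (forall x, 0 <= v x)%R ->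
  forall x, (0 <= glue A u v x)%R.
Proof. by move=> u0 v0 x; rewrite /glue; case: ifP. Qed.

Lemma measurable_glue A u v : measurable A ->
  measurable_fun [set: X] u -> measurable_fun [set: X] v ->
  measurable_fun [set: X] (glue A u v).
Proof.
move=> mA mu_ mv; apply: measurable_fun_ifT => //.
apply: (measurable_fun_bool true); rewrite setTI.
rewrite (_ : _ @^-1` _ = A)//; apply/seteqP; split => x /=; first exact: set_mem.
exact: mem_set.
Qed.

Lemma integral_glue (h : R -> R) A B u v :
  measurable A -> measurable B -> [disjoint A & B] ->
  measurable_fun [set: X] (fun x => h (glue A u v x)) ->
  (forall x, 0 <= h (glue A u v x))%R ->
  \int[mu]_(x in A `|` B) (h (glue A u v x))%:E
  = \int[mu]_(x in A) (h (u x))%:E + \int[mu]_(x in B) (h (v x))%:E.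
Proof.
move=> mA mB AB mh h0; rewrite ge0_integral_setU//; last 2 first.
- by apply/measurable_EFinP; exact: measurable_funTS.
- by move=> x _; rewrite lee_fin.
congr (_ + _); apply: eq_integral => x /set_mem; first by move=> Ax; rewrite glue_in.
move=> Bx; rewrite glue_out// => Ax.
by move/disj_set2P : AB => /seteqP[+ _] => /(_ x); exact.
Qed.

End Glue.

(** * Reducing the excess *)

Section Sharpness.
Context {R : realType} {d : measure_display} {X : measurableType d}.
Variables (mu : probability X R) (T : set (set X)) (C : set X -> set (set X)).
Hypothesis H : tree_with_children mu T C.
Variable p : R.
Hypothesis p1 : (1 < p)%R.
Local Notation r := (p / (p - 1))%R.

Let measurable_powR_comp (u : X -> R) s : measurable_fun [set: X] u ->
  measurable_fun [set: X] (fun x => u x `^ s)%R.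
Proof.
move=> mu_; apply: (@measurableT_comp _ _ _ _ _ _ (@powR R ^~ s)) => //.
Qed.

(** D bounds the normalized gap in the inequality of exponent q = p on E. The
function g is a measurable minorant of the maximal function computed with the
tree elements inside E only; this locality is what allows functions on disjoint
sets to be combined. *)
Record excess_pair (E : set X) (D : R) (phi g : X -> R) : Prop := {
  excess_measurable_phi : measurable_fun [set: X] phi;
  excess_measurable_g : measurable_fun [set: X] g;
  excess_phi_ge0 : forall x, (0 <= phi x)%R;
  excess_g_ge0 : forall x, (0 <= g x)%R;
  excess_average : forall x, E x ->
    exists J, [/\ T J, J x, J `<=` E & (g x)%:E <= average mu phi J];
  excess_mean : \int[mu]_(x in E) (phi x)%:E = mu E;
  excess_finite : \int[mu]_(x in E) (phi x `^ p)%:E < +oo;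
  excess_bound : (r `^ p)%:E * \int[mu]_(x in E) (phi x `^ p)%:E <=
    \int[mu]_(x in E) (g x `^ p)%:E + D%:E * mu E }.

Definition excess_le (D : R) (E : set X) : Prop := exists phi g, excess_pair E D phi g.

Lemma average_constant (c : R) (u : X -> R) I : T I ->
  \int[mu]_(x in I) (u x)%:E = c%:E * mu I -> average mu u I = c%:E.
Proof.
move=> TI; have [m m0 mI] := tree_measure_EFin H TI.
rewrite /average mI inver gt_eqF// => ->; rewrite -!EFinM; congr EFin.
by field; rewrite gt_eqF.
Qed.

Lemma excess_le_set0 D : excess_le D set0.
Proof.
exists (cst 0%R), (cst 0%R); split => //; rewrite ?integral_set0 ?measure0//.
by rewrite !mule0 adde0.
Qed.

Lemma excess_le_constant I : T I -> excess_le (r `^ p) I.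
Proof.
move=> TI; have mI := tree_measurable H TI.
have I1 : \int[mu]_(x in I) 1%:E = mu I.
  by have := @integral_cst _ _ _ mu I mI 1; rewrite mul1e.
exists (cst 1%R), (cst 1%R); split => //=.
- move=> x Ix; exists I; split => //.
  by rewrite (@average_constant 1 (cst 1%R))// mul1e.
- rewrite powR1 I1; have /andP[_ //] := tree_measure H TI.
- by rewrite powR1 I1 leeDr.
Qed.

Lemma excess_leU D A B : measurable A -> measurable B -> [disjoint A & B] ->
  excess_le D A -> excess_le D B -> excess_le D (A `|` B).
Proof.
move=> mA mB AB [u [gu hu]] [v [gv hv]].
exists (glue A u v), (glue A gu gv).
have m1 := measurable_glue mA (excess_measurable_phi hu) (excess_measurable_phi hv).
have m2 := measurable_glue mA (excess_measurable_g hu) (excess_measurable_g hv).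
have p1_ := glue_ge0 A (excess_phi_ge0 hu) (excess_phi_ge0 hv).
have p2_ := glue_ge0 A (excess_g_ge0 hu) (excess_g_ge0 hv).
have IP u1 v1 : measurable_fun [set: X] (glue A u1 v1) ->
    \int[mu]_(x in A `|` B) (glue A u1 v1 x `^ p)%:E
    = \int[mu]_(x in A) (u1 x `^ p)%:E + \int[mu]_(x in B) (v1 x `^ p)%:E.
  move=> mg; apply: (@integral_glue _ _ _ _ (fun y => y `^ p)%R) => //.
    exact: measurable_powR_comp.
  by move=> x; exact: powR_ge0.
have ABx x : B x -> ~ A x.
  by move=> Bx Ax; move/disj_set2P : AB => /seteqP[+ _] => /(_ x); exact.
have AE (u1 v1 : X -> R) J : J `<=` A -> average mu (glue A u1 v1) J = average mu u1 J.
  move=> JA; rewrite /average; congr (_ * _).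
  by apply: eq_integral => x /set_mem/JA Ax; rewrite glue_in.
have BE (u1 v1 : X -> R) J : J `<=` B -> average mu (glue A u1 v1) J = average mu v1 J.
  move=> JB; rewrite /average; congr (_ * _).
  by apply: eq_integral => x /set_mem/JB/ABx Ax; rewrite glue_out.
have mAB : mu (A `|` B) = mu A + mu B by rewrite measureU//; exact/disj_set2P.
split => //.
- move=> x [Ax|Bx].
    have [J [TJ Jx JA hJ]] := excess_average hu Ax.
    by exists J; rewrite AE// glue_in//; split => // y /JA; left.
  have [J [TJ Jx JB hJ]] := excess_average hv Bx.
  by exists J; rewrite BE// glue_out//; [split => // y /JB; right|exact: ABx].
- rewrite (@integral_glue _ _ _ _ id)// (excess_mean hu) (excess_mean hv) mAB//.
- rewrite (IP _ _ m1); exact: lte_add_pinfty (excess_finite hu) (excess_finite hv).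
rewrite !IP// mAB.
have nn (w : X -> R) E : 0 <= \int[mu]_(x in E) (w x `^ p)%:E.
  by apply: integral_ge0 => x _; rewrite lee_fin powR_ge0.
have [a a0 aE] := probability_EFin mu mA.
have [b b0 bE] := probability_EFin mu mB.
rewrite ge0_muleDr// aE bE -EFinD -EFinM mulrDr EFinD addeACA !EFinM -aE -bE.
by apply: leeD; [exact: (excess_bound hu)|exact: (excess_bound hv)].
Qed.

(** The integrals of phi^p and g^p over E enter as U and G; s, rho and c are the
p-th powers of r, of the factor on E and of the constant off E. *)
Lemma excess_step_arith (s rho c a m D D' : R) (U G : \bar R) :
  0 <= U -> U < +oo -> 0 <= G -> (0 < rho)%R -> (0 < m)%R ->
  s%:E * U <= G + (D * ((1 - a) * m))%:E ->
  (a * (s * c - 1) + (1 - a) * rho * D <= D')%R ->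
  s%:E * (rho%:E * U + (c * (a * m))%:E)
    <= rho%:E * G + (a * m)%:E + (D' * m)%:E.
Proof.
move=> U0 Uoo G0 rho0 m0.
have /fineK <- : U \is a fin_num by rewrite ge0_fin_numE.
have [->|/eqP Goo] := eqVneq G +oo.
  by move=> _ _; rewrite gt0_muley ?lte_fin// !addye// leey.
have /fineK <- : G \is a fin_num by rewrite ge0_fin_numE// lt_neqAle leey andbT; apply/eqP.
rewrite !(=^~ EFinM, =^~ EFinD) !lee_fin => h1 h2.
have := ler_wpM2l (ltW rho0) h1; have := ler_wpM2r (ltW m0) h2; lra.
Qed.

(** The new function is (1 + k a) phi on E and 1 - k + k a on the rest of I, where
its maximal function is at least its mean 1 over I. The two values are balanced
so that this mean is indeed 1:
(1 - a) (1 + k a) + a (1 - k + k a) = 1. *)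
Lemma excess_le_step D D' k a E I : T I -> measurable E -> E `<=` I ->
  mu E = (1 - a)%:E * mu I -> (0 < a < 1)%R -> (0 <= k <= 1)%R ->
  (a * ((r * (1 - k + k * a)) `^ p - 1) + (1 - a) * (1 + k * a) `^ p * D <= D')%R ->
  excess_le D E -> excess_le D' I.
Proof.
move=> TI mE EI muE /andP[a0 a1] /andP[k0 k1] hD [u [g hu]].
have mI := tree_measurable H TI.
have [m m0 mIE] := tree_measure_EFin H TI.
have p0 : (0 < p)%R by exact: lt_trans ltr01 p1.
have r0 : (0 <= r)%R by rewrite divr_ge0 ?subr_ge0 ?ltW.
pose B := I `\` E.
have mB : measurable B by exact: measurableD.
have EB : [disjoint E & B] by apply/disj_set2P; rewrite setDIK.
have UE : E `|` B = I by exact: setDUK.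
have muB : mu B = (a * m)%:E.
  have : mu I = mu E + mu B by rewrite -UE measureU//; exact/disj_set2P.
  have [b _ ->] := probability_EFin mu mB.
  by rewrite muE mIE -EFinM -EFinD => -[] ?; congr EFin; lra.
have muE' : mu E = ((1 - a) * m)%:E by rewrite muE mIE.
set rho := (1 + k * a)%R; set c := (1 - k + k * a)%R.
have rho0 : (0 < rho)%R by rewrite /rho; nra.
have c0 : (0 <= c)%R by rewrite /c; nra.
pose u' x := (rho * u x)%R; pose g' x := (rho * g x)%R.
have mu' : measurable_fun [set: X] u'.
  by apply: measurable_funM => //; exact: (excess_measurable_phi hu).
have mg' : measurable_fun [set: X] g'.
  by apply: measurable_funM => //; exact: (excess_measurable_g hu).
have u0 := excess_phi_ge0 hu; have g0 := excess_g_ge0 hu.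
have u'0 x : (0 <= u' x)%R by rewrite mulr_ge0// ltW.
have g'0 x : (0 <= g' x)%R by rewrite mulr_ge0// ltW.
have mphi : measurable_fun [set: X] (glue E u' (cst c)) by exact: measurable_glue.
have mg : measurable_fun [set: X] (glue E g' (cst 1%R)) by exact: measurable_glue.
have phi0 : forall x, (0 <= glue E u' (cst c) x)%R by exact: glue_ge0.
have gg0 : forall x, (0 <= glue E g' (cst 1%R) x)%R by apply: glue_ge0 => // x; exact: ler01.
have intB (t : R) : \int[mu]_(x in B) t%:E = (t * (a * m))%:E.
  rewrite EFinM -muB; exact: (integral_cst mu mB t%:E).
have intE (w : X -> R) : measurable_fun [set: X] w -> (forall x, 0 <= w x)%R ->
    \int[mu]_(x in E) ((rho * w x) `^ p)%:E
    = (rho `^ p)%:E * \int[mu]_(x in E) (w x `^ p)%:E.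
  move=> mw w0; rewrite -(@ge0_integralMl_EFin _ _ _ _ _ mE _ (fun x => w x `^ p)%R) ?powR_ge0//.
  - by apply: eq_integral => x _; rewrite powRM// ltW.
  - exact: measurable_powR_comp.
  - by move=> x; exact: powR_ge0.
have intI (w : X -> R) (t : R) : measurable_fun [set: X] w -> (forall x, 0 <= w x)%R ->
    measurable_fun [set: X] (glue E (fun x => rho * w x)%R (cst t)) ->
    \int[mu]_(x in I) (glue E (fun x => rho * w x)%R (cst t) x `^ p)%:E =
    (rho `^ p)%:E * \int[mu]_(x in E) (w x `^ p)%:E + (t `^ p * (a * m))%:E.
  move=> mw w0 mgl; rewrite -UE (@integral_glue _ _ _ _ (fun y => y `^ p)%R)//.
  - by congr (_ + _); [exact: intE|exact: (intB (t `^ p)%R)].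
  - exact: measurable_powR_comp.
  - by move=> x; exact: powR_ge0.
have mean : \int[mu]_(x in I) (glue E u' (cst c) x)%:E = mu I.
  rewrite -{1}UE (@integral_glue _ _ _ _ id)// ge0_integralMl_EFin ?(ltW rho0)//; last first.
    exact: (excess_measurable_phi hu).
  rewrite (excess_mean hu) intB muE' mIE -EFinM -EFinD; congr EFin.
  by rewrite /rho /c; ring.
have nn (w : X -> R) : 0 <= \int[mu]_(x in E) (w x `^ p)%:E.
  by apply: integral_ge0 => x _; rewrite lee_fin powR_ge0.
have Ufin := excess_finite hu.
exists (glue E u' (cst c)), (glue E g' (cst 1%R)).
split; [exact: mphi|exact: mg|exact: phi0|exact: gg0| |exact: mean| |].
- move=> x Ix; have [Ex|Ex] := pselect (E x).
    have [J [TJ Jx JE hJ]] := excess_average hu Ex.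
    exists J; split => //; first exact: subset_trans EI.
    have -> : average mu (glue E u' (cst c)) J = rho%:E * average mu u J.
      rewrite /average muleCA; congr (_ * _).
      rewrite -ge0_integralMl_EFin ?(ltW rho0)//; last 2 first.
        exact: (tree_measurable H TJ).
        exact: (excess_measurable_phi hu).
      by apply: eq_integral => y /set_mem/JE Ey; rewrite glue_in.
    by rewrite glue_in// EFinM lee_wpmul2l// lee_fin ltW.
  exists I; split => //; rewrite glue_out//=.
  by rewrite (@average_constant 1)// mul1e.
- rewrite intI//; last exact: (excess_measurable_phi hu).
  by rewrite lte_add_pinfty ?ltry// lte_mul_pinfty ?lee_fin ?powR_ge0.
rewrite !intI//; [|exact: (excess_measurable_g hu)|exact: (excess_measurable_phi hu)].
rewrite powR1 mul1r mIE -EFinM; apply: (@excess_step_arith _ _ _ _ _ D) => //.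
- exact: powR_gt0.
- by rewrite EFinM -muE'; exact: (excess_bound hu).
by rewrite -powRM.
Qed.

(** The proportion a given by [tree_fraction] depends on I, but it is at least
a0 / 2; hence the gain e is uniform in I and in D. *)
Lemma excess_le_improve (D0 : R) : (r < D0)%R -> exists2 e : R, (0 < e)%R &
  forall D, (D0 <= D)%R -> (forall I, T I -> excess_le D I) ->
    forall I, T I -> excess_le (D - e) I.
Proof.
move=> rD0; have [k [a0 [e [/andP[k0 k1] /andP[a00 a01] e0 he]]]] :=
  self_improvement_parameters p1 rD0.
have al0 : (0 < a0 / 2)%R by rewrite divr_gt0.
exists (a0 / 2 * e)%R => [|D D0D hD I TI]; first exact: mulr_gt0.
have [||||E [a [mE EI hE /andP[a1 a2] muE]]] := tree_fraction (P := excess_le D) H TI al0.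
- by rewrite ltr_pdivrMr//; lra.
- exact: excess_le_set0.
- exact: hD.
- exact: excess_leU.
have aa0 : (a <= a0)%R by lra.
apply: (@excess_le_step D _ k a E) => //; [lra|lra|].
apply: le_trans (he a D _ aa0 D0D) _; first lra.
by rewrite lerD2l lerN2 ler_pM2r.
Qed.

Lemma excess_le_limit (D0 : R) : (r < D0)%R ->
  exists2 D : R, (D <= D0)%R & forall I, T I -> excess_le D I.
Proof.
move=> rD0; have [e e0 he] := excess_le_improve rD0.
have hn n : exists2 D : R, (D <= Num.max D0 (r `^ p - n%:R * e))%R &
    forall I, T I -> excess_le D I.
  elim: n => [|n [D hD DI]].
    exists (r `^ p)%R; last exact: excess_le_constant.
    by rewrite mul0r subr0 le_max lexx orbT.
  have [DD0|D0D] := leP D D0; first by exists D => //; rewrite le_max DD0.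
  exists (D - e)%R; last exact: he (ltW D0D) DI.
  move: hD; rewrite !le_max leNgt D0D /= => hD; apply/orP; right.
  by rewrite -natr1 mulrDl mul1r; lra.
have [D hD DI] := hn (Num.truncn (r `^ p / e)).+1.
exists D => //; apply: le_trans hD _; rewrite ge_max lexx /=.
apply: (@le_trans _ _ 0%R).
  by rewrite subr_le0 -ler_pdivrMr// ltW// truncnS_gt.
apply: ltW (le_lt_trans _ rD0); rewrite divr_ge0 ?subr_ge0 ?ltW//.
exact: lt_trans ltr01 p1.
Qed.

End Sharpness.

(** * Near-extremal functions *)

Lemma young_poweR {R : realType} (p q s : R) (M : \bar R) :
  (1 <= q)%R -> (q <= p)%R -> (0 <= s)%R -> 0 < M ->
  (p * s `^ q)%:E * M `^ (p - q) <= (q * s `^ p)%:E + (p - q)%:E * M `^ p.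
Proof.
move=> q1 qp s0; case: M => [m| |]//.
  rewrite lte_fin !poweR_EFin -!EFinM -EFinD lee_fin -mulrA => m0.
  exact: young_powR_power.
have p0 : (0 < p)%R by lra.
move=> _; have [->|qneq] := eqVneq q p.
  by rewrite subrr poweRe0 mule1 mul0e adde0.
rewrite [X in _ + _ * X]poweRyr ?gt_eqF// gt0_muley; first by rewrite addey// leey.
by rewrite lte_fin subr_gt0 lt_neqAle qneq.
Qed.

Lemma sharp_top_arith {R : realType} (s F K D : R) (A G U : \bar R) :
  (0 < F)%R -> (D < K)%R -> 0 <= A -> 0 <= G -> 0 <= U -> U < +oo ->
  F%:E * G <= A -> s%:E * U <= G + D%:E ->
  s%:E * (F%:E * U) < A + (K * F)%:E.
Proof.
move=> F0 DK A0 G0 U0 Uoo.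
have /fineK <- : U \is a fin_num by rewrite ge0_fin_numE.
have [->|/eqP Aoo] := eqVneq A +oo; first by move=> _ _; rewrite addye// -!EFinM ltry.
have /fineK <- : A \is a fin_num by rewrite ge0_fin_numE// lt_neqAle leey andbT; apply/eqP.
have [->|/eqP Goo] := eqVneq G +oo; first by rewrite gt0_muley ?lte_fin// leNgt ltry.
have /fineK <- : G \is a fin_num by rewrite ge0_fin_numE// lt_neqAle leey andbT; apply/eqP.
rewrite !(=^~ EFinM, =^~ EFinD) !lee_fin lte_fin => h1 h2.
have h3 := ler_wpM2l (ltW F0) h2.
have h4 : (0 < (K - D) * F)%R by rewrite mulr_gt0// subr_gt0.
lra.
Qed.

Lemma sharp_exponent_arith {R : realType} (p q s c K F : R) (A P B : \bar R) :
  (0 < p)%R -> (0 < q)%R -> (0 < c)%R ->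
  A \is a fin_num -> P \is a fin_num -> 0 <= B ->
  (p * c)%:E * B <= (q * s)%:E * P + (p - q)%:E * A ->
  s%:E * P < A + (p * K / q * F)%:E ->
  (- K * F)%:E + c%:E * B < A.
Proof.
move=> p0 q0 c0 /fineK <- /fineK <- B0.
have [->|/eqP Boo] := eqVneq B +oo.
  by rewrite gt0_muley ?lte_fin ?mulr_gt0// !(=^~ EFinM, =^~ EFinD) leNgt ltry.
have /fineK <- : B \is a fin_num by rewrite ge0_fin_numE// lt_neqAle leey andbT; apply/eqP.
rewrite !(=^~ EFinM, =^~ EFinD) lee_fin !lte_fin => h1 h2.
have := h2; rewrite -(ltr_pM2l q0) => h3.
have E : (q * (fine A + p * K / q * F) = q * fine A + p * (K * F))%R by field; rewrite gt_eqF.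
rewrite -(ltr_pM2l p0); rewrite E in h3; lra.
Qed.

Section Extremizers.
Context {R : realType} {d : measure_display} {X : measurableType d}.
Variables (mu : probability X R) (T : set (set X)) (C : set X -> set (set X)).
Hypothesis H : tree_with_children mu T C.

(** The exponent q = p: a function of small excess on the root X, scaled to have
integral f. *)
Lemma sharp_top_exponent (p f K : R) : (1 < p)%R -> (0 < f)%R -> (p / (p - 1) < K)%R ->
  exists phi : X -> R,
    [/\ measurable_fun [set: X] phi, (forall x, (0 <= phi x)%R),
        \int[mu]_x (phi x)%:E = f%:E,
        \int[mu]_x (phi x `^ p)%:E < +oo &
        ((p / (p - 1)) `^ p)%:E * \int[mu]_x (phi x `^ p)%:E
        < \int[mu]_x (maximal_op mu T phi x `^ p) + (K * f `^ p)%:E].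
Proof.
move=> p1 f0 rK.
have p0 : (0 < p)%R by lra.
pose K' := ((p / (p - 1) + K) / 2)%R.
have rK' : (p / (p - 1) < K')%R by rewrite /K'; lra.
have K'K : (K' < K)%R by rewrite /K'; lra.
have [D DK' hD] := excess_le_limit H p1 rK'.
have [u [g hu]] := hD _ (tree_setT H).
have mpow (w : X -> R) : measurable_fun [set: X] w ->
    measurable_fun [set: X] (fun x => w x `^ p)%R.
  by move=> mw; apply: (@measurableT_comp _ _ _ _ _ _ (@powR R ^~ p)) => //.
have mu_ := excess_measurable_phi hu; have mg := excess_measurable_g hu.
have u0 := excess_phi_ge0 hu; have g0 := excess_g_ge0 hu.
pose phi x := (f * u x)%R.
have mphi : measurable_fun [set: X] phi by exact: measurable_funM.
have phi0 x : (0 <= phi x)%R by rewrite mulr_ge0// ltW.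
have phif : \int[mu]_x (phi x)%:E = f%:E.
  by rewrite ge0_integralMl_EFin ?(ltW f0)// (excess_mean hu) probability_setT mule1.
have intp (w : X -> R) : measurable_fun [set: X] w -> (forall x, 0 <= w x)%R ->
    \int[mu]_x ((f * w x) `^ p)%:E = (f `^ p)%:E * \int[mu]_x (w x `^ p)%:E.
  move=> mw w0.
  rewrite -(@ge0_integralMl_EFin _ _ _ mu _ _ _ (fun x => w x `^ p)%R) ?powR_ge0//.
  - by apply: eq_integral => x _; rewrite powRM// ltW.
  - exact: mpow.
  - by move=> x; exact: powR_ge0.
have gM : \int[mu]_x ((f * g x) `^ p)%:E <= \int[mu]_x (maximal_op mu T phi x `^ p).
  apply: ge0_le_integral => //.
  - by move=> x _; rewrite lee_fin powR_ge0.
  - by apply/measurable_EFinP/mpow; exact: measurable_funM.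
  - apply: (@measurableT_comp _ _ _ _ _ _ (@poweR R ^~ p)) => //.
      exact: measurable_poweR.
    exact: (measurable_maximal_op H mphi phi0 phif).
  move=> x _; rewrite -poweR_EFin.
  apply: gt0_ler_poweR; rewrite ?in_itv/= ?leey ?andbT ?lee_fin ?(ltW p0)//.
  - by rewrite mulr_ge0// ltW.
  - exact: (maximal_op_ge0 H mphi phi0 phif).
  have [J [TJ Jx _ hJ]] := excess_average hu (I : [set: X] x).
  apply: (@le_trans _ _ (average mu phi J)).
    have -> : average mu phi J = f%:E * average mu u J.
      rewrite /average muleCA; congr (_ * _).
      by rewrite -ge0_integralMl_EFin ?(ltW f0)//; exact: (tree_measurable H TJ).
    by rewrite EFinM lee_wpmul2l// lee_fin ltW.
  apply: ereal_sup_ubound; exists J => //.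
  by rewrite (_ : (fun y => `|phi y|%R) = phi)//; apply/funext => y; rewrite ger0_norm.
have F0 := powR_gt0 p f0.
have uoo := excess_finite hu.
have U0 : 0 <= \int[mu]_x (u x `^ p)%:E.
  by apply: integral_ge0 => x _; rewrite lee_fin powR_ge0.
have G0 : 0 <= \int[mu]_x (g x `^ p)%:E.
  by apply: integral_ge0 => x _; rewrite lee_fin powR_ge0.
have A0 : 0 <= \int[mu]_x maximal_op mu T phi x `^ p.
  by apply: integral_ge0 => x _; exact: poweR_ge0.
have hb := excess_bound hu; rewrite probability_setT mule1 in hb.
rewrite intp// in gM.
have DK : (D < K)%R by exact: le_lt_trans K'K.
exists phi; split; [exact: mphi|exact: phi0|exact: phif| |]; rewrite (intp u mu_ u0).
  by rewrite lte_mul_pinfty ?lee_fin ?powR_ge0.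
exact: (@sharp_top_arith _ _ _ _ _ _ _ _ F0 DK A0 G0 U0 uoo gM hb).
Qed.

(** The near-extremizer for q = p serves for all q: its defect K' f^p becomes
(q / p) K' f^p, and K' = p K / q exceeds r exactly when K exceeds q / (p - 1).
The case q = p of [maximal_inequality] makes the integral of M^p finite. *)
Lemma sharp_all_exponents (p q f K : R) :
  (1 < p)%R -> (1 <= q)%R -> (q <= p)%R -> (0 < f)%R -> (q / (p - 1) < K)%R ->
  exists phi : X -> R,
    [/\ measurable_fun [set: X] phi, (forall x, (0 <= phi x)%R),
        \int[mu]_x (phi x)%:E = f%:E &
        (- K * (f `^ p))%:E
        + ((p / (p - 1)) `^ q)%:E
          * \int[mu]_x ((phi x `^ q)%:E * maximal_op mu T phi x `^ (p - q))
        < \int[mu]_x (maximal_op mu T phi x `^ p)].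
Proof.
move=> p1 q1 qp f0 qK.
have p0 : (0 < p)%R by lra.
have q0 : (0 < q)%R by lra.
have r_gt0 : (0 < p / (p - 1))%R by rewrite divr_gt0//; lra.
have r0 := ltW r_gt0.
have rK : (p / (p - 1) < p * K / q)%R.
  rewrite ltr_pdivlMr// -mulrA ltr_pM2l//; move: qK; lra.
have [phi [mphi phi0 phif phioo sharp]] := sharp_top_exponent p1 f0 rK.
exists phi; split => //.
have mM := measurable_maximal_op H mphi phi0 phif.
have M0 x : 0 < maximal_op mu T phi x.
  by apply: lt_le_trans (maximal_op_ge H mphi phi0 phif x); rewrite lte_fin.
have mMs s : measurable_fun [set: X] (fun x => maximal_op mu T phi x `^ s).
  by apply: (@measurableT_comp _ _ _ _ _ _ (@poweR R ^~ s)) => //; exact: measurable_poweR.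
have mpow s : measurable_fun [set: X] (fun x => phi x `^ s)%R.
  by apply: (@measurableT_comp _ _ _ _ _ _ (@powR R ^~ s)) => //.
have P0 : 0 <= \int[mu]_x (phi x `^ p)%:E.
  by apply: integral_ge0 => x _; rewrite lee_fin powR_ge0.
have Pfin : \int[mu]_x (phi x `^ p)%:E \is a fin_num by rewrite ge0_fin_numE.
have A0 : 0 <= \int[mu]_x maximal_op mu T phi x `^ p.
  by apply: integral_ge0 => x _; exact: poweR_ge0.
have Afin : \int[mu]_x maximal_op mu T phi x `^ p \is a fin_num.
  rewrite ge0_fin_numE//.
  apply: le_lt_trans (maximal_inequality H mphi phi0 phif p1 (ltW p1) (lexx p)) _.
  under eq_integral do rewrite subrr poweRe0 mule1.
  by rewrite -(fineK Pfin) -EFinM -EFinD ltry.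
have B0 : 0 <= \int[mu]_x ((phi x `^ q)%:E * maximal_op mu T phi x `^ (p - q)).
  by apply: integral_ge0 => x _; rewrite mule_ge0 ?poweR_ge0// lee_fin powR_ge0.
have young : (p * (p / (p - 1)) `^ q)%:E
      * \int[mu]_x ((phi x `^ q)%:E * maximal_op mu T phi x `^ (p - q)) <=
    (q * (p / (p - 1)) `^ p)%:E * \int[mu]_x (phi x `^ p)%:E
    + (p - q)%:E * \int[mu]_x maximal_op mu T phi x `^ p.
  have cq : (0 <= p * (p / (p - 1)) `^ q)%R by rewrite mulr_ge0 ?powR_ge0// ltW.
  have cp : (0 <= q * (p / (p - 1)) `^ p)%R by rewrite mulr_ge0 ?powR_ge0// ltW.
  have pq : (0 <= p - q)%R by rewrite subr_ge0.
  have mB : measurable_fun [set: X]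
      (fun x => (phi x `^ q)%:E * maximal_op mu T phi x `^ (p - q)).
    by apply: emeasurable_funM => //; exact/measurable_EFinP.
  have mP : measurable_fun [set: X] (fun x => (phi x `^ p)%:E) by exact/measurable_EFinP.
  have nnB x : 0 <= (phi x `^ q)%:E * maximal_op mu T phi x `^ (p - q).
    by rewrite mule_ge0 ?poweR_ge0// lee_fin powR_ge0.
  have nnP x : 0 <= (phi x `^ p)%:E by rewrite lee_fin powR_ge0.
  have nnM x : 0 <= maximal_op mu T phi x `^ p by exact: poweR_ge0.
  rewrite -[leLHS]ge0_integralZl// -[X in _ <= X + _]ge0_integralZl//.
  rewrite -[X in _ <= _ + X]ge0_integralZl// -ge0_integralD//; last 4 first.
  - by move=> x _; rewrite mule_ge0// lee_fin.
  - exact: measurable_funeM.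
  - by move=> x _; rewrite mule_ge0// lee_fin.
  - exact: measurable_funeM.
  apply: ge0_le_integral => //.
  - by move=> x _; rewrite mule_ge0// lee_fin.
  - exact: measurable_funeM.
  - by apply: emeasurable_funD; exact: measurable_funeM.
  move=> x _.
  have := young_poweR q1 qp (mulr_ge0 r0 (phi0 x)) (M0 x).
  by rewrite !(powRM _ r0 (phi0 x)) !mulrA EFinM -muleA [(q * _ * _)%:E]EFinM.
exact: (sharp_exponent_arith p0 q0 (powR_gt0 q r_gt0) Afin Pfin B0 young sharp).
Qed.

End Extremizers.

Theorem corollary1 (R : realType) (d : measure_display) (X : measurableType d)
    (mu : probability X R) (mu_nonatomic : nonatomic mu)
    (T : set (set X)) (T_tree : is_tree mu T)
    (p : R) (p_gt1 : (1 < p)%R) :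
  (forall (f : R) (phi : X -> R),
     measurable_fun [set: X] phi -> (forall x, (0 <= phi x)%R) ->
     \int[mu]_x (phi x)%:E = f%:E ->
     forall q : R, (1 <= q)%R -> (q <= p)%R ->
       \int[mu]_x (maximal_op mu T phi x `^ p) <=
         (- (q / (p - 1)) * (f `^ p))%R%:E
         + ((p / (p - 1)) `^ q)%R%:E
           * \int[mu]_x ((phi x `^ q)%R%:E * maximal_op mu T phi x `^ (p - q)%R))
  /\
  (forall q : R, (1 <= q)%R -> (q <= p)%R ->
   forall f : R, (0 < f)%R ->
   forall C : R, (q / (p - 1) < C)%R ->
   exists phi : X -> R,
     [/\ measurable_fun [set: X] phi, (forall x, (0 <= phi x)%R),
         \int[mu]_x (phi x)%:E = f%:E &
         (- C * (f `^ p))%R%:E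
         + ((p / (p - 1)) `^ q)%R%:E
           * \int[mu]_x ((phi x `^ q)%R%:E * maximal_op mu T phi x `^ (p - q)%R)
         < \int[mu]_x (maximal_op mu T phi x `^ p)]).
Proof.
have [C H] := T_tree; split.
  move=> f phi mphi phi0 phif q q1 qp.
  exact: (maximal_inequality H mphi phi0 phif p_gt1 q1 qp).
by move=> q q1 qp f f0 K qK; exact: (sharp_all_exponents H p_gt1 q1 qp f0 qK).
Qed.
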